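(* The Catalan numbers $C_n=\frac{1}{n+1}\binom{2n}{n}$ satisfy, for all integers $n\geq 1$, the recurrence relation $$C_n=\sum_{\substack{r+s+t=n-1\\ r,s\geq 1;\ t\geq 0}}C_rC_s2^t+2^{n-1},$$ where the sum is over all triples of integers $(r,s,t)$ satisfying the indicated conditions. *)

(* Defs.v *)
From mathcomp Require Import all_boot all_order all_algebra.

Set Implicit Arguments.
Unset Strict Implicit.
Unset Printing Implicit Defensive.

Import GRing.Theory.
Local Open Scope ring_scope.

(* Rational-valued, so that the division is exact by construction. *)
Definition catalan (n : nat) : rat := n.+1%:R^-1 * 'C((2 * n)%N, n)%:R.

(* Main.v *)
Require Import Defs.
From mathcomp Require Import all_boot all_order all_algebra.
From mathcomp Require Import zify ring.

(** Let [S n] be the right-hand side.  Splitting off the triples with [t = 0]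
    gives [S (n+1) = 2 S n + \sum_(r+s=n; r,s >= 1) C_r C_s], and Segner's
    recurrence [C_(n+1) = \sum_(r+s=n) C_r C_s] says that the Catalan numbers
    satisfy the same relation, [2 C_n] being the terms with [r = 0] or [s = 0].
    Segner's recurrence itself follows from Gosper summation. *)

Set Implicit Arguments.
Unset Strict Implicit.
Unset Printing Implicit Defensive.

Import GRing.Theory Num.Theory.
Local Open Scope ring_scope.

(** Two absorption steps, from ['C(2n+2, n+1)] to ['C(2n+1, n)] to ['C(2n, n)]. This ratio is what
    turns the Gosper step into an identity of rational functions. *)
Lemma central_binS (n : nat) :
  'C((2 * n.+1)%N, n.+1)%:R = 2 * (2 * n%:R + 1) / n.+1%:R * 'C((2 * n)%N, n)%:R :> rat.
Proof.
have E : (n.+1 * 'C(2 * n.+1, n.+1) = 2 * (2 * n + 1) * 'C(2 * n, n))%N.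
  have h1 := mul_bin_diag (2 * n).+2 n.
  have h2 := mul_bin_down (2 * n).+1 n.
  have -> : (2 * n.+1 = (2 * n).+2)%N by lia.
  move: h1 h2; rewrite /= (_ : ((2 * n).+1 - n = n.+1)%N); last by lia.
  nia.
have n0 : n.+1%:R != 0 :> rat by rewrite pnatr_eq0.
apply: (mulfI n0); move/(congr1 (fun k => k%:R : rat)): E.
rewrite !natrM natrD natrM => ->.
by field; rewrite addrC natr1.
Qed.

Lemma catalan0 : catalan 0 = 1.
Proof. by rewrite /catalan bin0 invr1 mulr1. Qed.

(** Gosper antidifference in [i] of [catalan i * catalan (n - i)]. *)
Definition gosper_catalan (n i : nat) : rat :=
  'C((2 * i)%N, i)%:R * 'C((2 * (n.+1 - i))%N, (n.+1 - i)%N)%:R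
  * (2 * i%:R - n.+1%:R) / (2 * n.+1%:R * n.+2%:R).

Lemma gosper_catalanB (n i : nat) : (i <= n)%N ->
  gosper_catalan n i.+1 - gosper_catalan n i = catalan i * catalan (n - i).
Proof.
(* With [n = i + j] there is no truncated subtraction left, and both sides become rational multiples
   of ['C(2i, i) * 'C(2j, j)]. *)
move=> /subnKC; set j := (n - i)%N => <-.
rewrite /gosper_catalan /catalan.
rewrite (_ : ((i + j).+1 - i.+1 = j)%N); last by lia.
rewrite (_ : ((i + j).+1 - i = j.+1)%N); last by lia.
rewrite !central_binS.
have nz k : k.+1%:R != 0 :> rat by rewrite pnatr_eq0.
have := nz i; have := nz j; have := nz (i + j)%N; have := nz (i + j).+1.
rewrite -!natr1 natrD => h1 h2 h3 h4.
field.
by rewrite h1 h2 h3 h4.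
Qed.

Lemma catalan_convolution (n : nat) :
  catalan n.+1 = \sum_(i < n.+1) catalan i * catalan (n - i).
Proof.
rewrite (eq_bigr (fun i : 'I__ => gosper_catalan n i.+1 - gosper_catalan n i)); last first.
  by move=> i _; rewrite gosper_catalanB // -ltnS.
rewrite -(big_mkord xpredT (fun i => gosper_catalan n i.+1 - gosper_catalan n i)).
(* The factor [2i - (n+1)] changes sign under [i -> n+1-i], so the values at [n+1] and [0] are
   opposite and each endpoint contributes half of [catalan n.+1]. *)
rewrite telescope_sumr // /gosper_catalan /catalan subnn subn0 muln0 bin0.
have h1 : n.+1%:R != 0 :> rat by rewrite pnatr_eq0.
have h2 : n.+2%:R != 0 :> rat by rewrite pnatr_eq0.
move: n.+1%:R n.+2%:R 'C(_, _)%:R h1 h2 => x y c h1 h2.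
by field; rewrite h1 h2.
Qed.

Definition weighted_triple_sum (F : nat -> nat -> rat) (m : nat) : rat :=
  \sum_(r < m.+1) \sum_(s < m.+1)
    \sum_(t < m.+1 | [&& (r + s + t)%N == m, (1 <= r)%N & (1 <= s)%N])
      F r s * 2 ^+ t.

Lemma weighted_triple_sumS (F : nat -> nat -> rat) (m : nat) :
  weighted_triple_sum F m.+1 =
    \sum_(i < m) F i.+1 (m - i)%N + 2 * weighted_triple_sum F m.
Proof.
pose T (r s : nat) :=
  \sum_(t < m.+1 | [&& (r + s + t)%N == m, (1 <= r)%N & (1 <= s)%N]) F r s * 2 ^+ t.
pose D (r s : nat) := if [&& (r + s)%N == m.+1, (1 <= r)%N & (1 <= s)%N] then F r s else 0.
(* Passing from [m] to [m.+1] lengthens the ranges of [r] and [s] by one; this vanishing discards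
   the extra index. *)
have T0 r s : (m < r + s)%N -> T r s = 0.
  by move=> ltm; rewrite /T big1 // => t /and3P[/eqP e _ _]; lia.
have innerE (r s : nat) :
    \sum_(t < m.+2 | [&& (r + s + t)%N == m.+1, (1 <= r)%N & (1 <= s)%N]) F r s * 2 ^+ t
    = D r s + 2 * T r s.
  rewrite big_mkcond big_ord_recl /= addn0 expr0 mulr1; congr (_ + _).
  rewrite /T mulr_sumr [RHS]big_mkcond /=; apply: eq_bigr => t _.
  rewrite /bump /= add1n addnS eqSS.
  by case: ifP => // _; rewrite exprS mulrCA.
rewrite /weighted_triple_sum.
under eq_bigr => r _ do under eq_bigr => s _ do rewrite innerE.
under eq_bigr => r _ do rewrite big_split /= -mulr_sumr.
rewrite big_split /= -mulr_sumr; congr (_ + 2 * _); last first.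
  rewrite big_ord_recr /= [X in _ + X]big1 ?addr0; last by move=> s _; apply: T0; lia.
  by apply: eq_bigr => r _; rewrite big_ord_recr /= T0 ?addr0 //; lia.
(* In the [D] part the row [r = 0] is excluded, and [r = m+1] would force [s = 0]. Each remaining
   row [r+1] keeps only [s = m - r], positive since [r < m]. *)
rewrite big_ord_recl /= big1 ?add0r; last by move=> s _; rewrite /D andbF.
rewrite big_ord_recr /= [X in _ + X]big1 ?addr0; last first.
  by move=> s _; rewrite /D /bump /=; case: ifP => // /andP[/eqP e ?]; lia.
apply: eq_bigr => r _.
have ltr := ltn_ord r.
have lts : (m - r < m.+2)%N by lia.
rewrite (bigD1 (Ordinal lts)) //= big1 ?addr0; last first.
  move=> s /eqP ns; rewrite /D /bump /=; case: ifP => // /andP[/eqP e _].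
  by case: ns; apply: val_inj => /=; lia.
by rewrite /D /bump /=; case: ifP => //; lia.
Qed.

Lemma catalan_weighted_triple_sum (m : nat) :
  catalan m.+1 = weighted_triple_sum (fun r s => catalan r * catalan s) m + 2 ^+ m.
Proof.
elim: m => [|m IHm].
  (* For [m = 0] no triple is admissible, and the power of 2 alone gives [catalan 1 = 1]. *)
  rewrite /weighted_triple_sum !big_ord1 big_pred0 ?add0r; last by move=> t; rewrite andbF.
  by rewrite catalan_convolution big_ord1 subn0 catalan0 mulr1.
rewrite weighted_triple_sumS exprS -addrA -mulrDr -IHm.
rewrite catalan_convolution big_ord_recl big_ord_recr /= subn0 catalan0 mul1r.
rewrite /bump /= add1n subnn catalan0 mulr1.
under eq_bigr => i _ do rewrite add1n subSS.
by ring.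
Qed.

(* Every index of an admissible triple is at most n - 1, so ranging over 'I_n
   loses none of them. *)
Theorem proposition4p1 (n : nat) (hn : (1 <= n)%N) :
  catalan n =
    \sum_(r < n) \sum_(s < n)
      \sum_(t < n | [&& (r + s + t)%N == (n - 1)%N, (1 <= r)%N & (1 <= s)%N])
        catalan r * catalan s * 2 ^+ t
    + 2 ^+ (n - 1).
Proof. by case: n hn => // m _; rewrite subn1; apply: catalan_weighted_triple_sum. Qed.
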